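(* Let $\mu,\nu$ be Borel probability measures on $\mathbb R$. Suppose that the cost function $c\in\mathcal C(\mu,\nu)$ is such that for all $x,y,x',y'\in\mathbb R$ both functions $(x',y')\mapsto c(x,y,x',y')$ (with $(x,y)$ fixed) and $(x,y)\mapsto c(x,y,x',y')$ (with $(x',y')$ fixed) are submodular (resp. supermodular). Then the comonotone coupling $\pi_{\rm com}$ (resp. the antimonotone coupling $\pi_{\rm ant}$) is a minimizer of $\pi\mapsto\iint c(x,y,x',y')\,\mathrm d\pi(x,y)\,\mathrm d\pi(x',y')$ over $\Pi(\mu,\nu)$.
   Context: $\Pi(\mu,\nu)$ is the set of all probability measures on $\mathbb R^2$ with marginals $\mu,\nu$. $\mathcal C(\mu,\nu)$ is the set of (measurable) functions $c:(\mathbb R\times\mathbb R)^2\to\mathbb R$ such that there exist $f\in L^1(\mu\otimes\mu)$ and $g\in L^1(\nu\otimes\nu)$ with $c(x,y,x',y')\ge f(x,x')+g(y,y')$ everywhere. A function $f:\mathbb R^2\to\mathbb R$ is submodular if $f(x,y)+f(x',y')\le f(x,y')+f(x',y)$ for all $x<x'$, $y<y'$, and supermodular if the reverse inequality holds. $Q_\mu(t)=\inf\{x\in\mathbb R:\mu((-\infty,x])\ge t\}$ is the left quantile function. With $U$ uniform on $[0,1]$, $\pi_{\rm com}\in\Pi(\mu,\nu)$ is the law of $(Q_\mu(U),Q_\nu(U))$ and $\pi_{\rm ant}\in\Pi(\mu,\nu)$ is the law of $(Q_\mu(U),Q_\nu(1-U))$. *)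

(* Defs.v *)
From HB Require Import structures.
From mathcomp Require Import all_boot all_order all_algebra.
From mathcomp Require Import all_classical all_reals all_analysis measurable_realfun.

Set Implicit Arguments.
Unset Strict Implicit.
Unset Printing Implicit Defensive.

Import Order.TTheory GRing.Theory Num.Theory.
Import numFieldNormedType.Exports.

Local Open Scope classical_set_scope.
Local Open Scope ring_scope.

(* measurableTypeR R carries the Borel sigma-algebra; plane R carries the
   product sigma-algebra, i.e. the Borel one on R^2. *)
Notation line R := (measurableTypeR R).
Notation plane R := (line R * line R)%type.

Section definitions.
Context {R : realType}.
Implicit Types (mu nu : probability (line R) R) (pi : probability (plane R) R).

Definition couplings mu nu : set (probability (plane R) R) :=
  [set pi | (forall A, measurable A -> pushforward pi fst A = mu A) /\
            (forall B, measurable B -> pushforward pi snd B = nu B)].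

(* The argument of c is grouped as ((x, y), (x', y')). *)
Definition cost_class mu nu : set (plane R * plane R -> R) :=
  [set c | measurable_fun setT c /\
    exists f g : plane R -> R,
      [/\ (mu \x mu)%E.-integrable setT (EFin \o f),
          (nu \x nu)%E.-integrable setT (EFin \o g) &
          forall x y x' y', f (x, x') + g (y, y') <= c ((x, y), (x', y'))]].

Definition submodular (f : R * R -> R) : Prop :=
  forall x x' y y', x < x' -> y < y' ->
    f (x, y) + f (x', y') <= f (x, y') + f (x', y).

Definition supermodular (f : R * R -> R) : Prop :=
  forall x x' y y', x < x' -> y < y' ->
    f (x, y') + f (x', y) <= f (x, y) + f (x', y').

(* The infimum is the usual one for 0 < t < 1; where it would be infinite
   (t <= 0, t > 1, possibly t = 1) it takes the default value 0, which does
   not affect laws under the uniform distribution on [0, 1]. *)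
Definition quantile mu (t : R) : R :=
  inf [set x : R | (t%:E <= mu `]-oo, x]%classic)%E].

Lemma quantile_nondecreasing mu (s t : R) :
  0 < s -> s <= t -> t < 1 -> quantile mu s <= quantile mu t.
Proof.
move=> s0 st t1; rewrite /quantile.
pose idTR : line R -> R := idfun.
pose idm := @isMeasurableFun.Build _ _ _ _ idTR (@measurable_id _ _ setT).
pose X : {RV mu >-> R} := HB.pack idTR idm.
have cdfE x : cdf X x = mu `]-oo, x]%classic by [].
have t1e : (t%:E < 1)%E by rewrite lte_fin.
have s0e : (0 < s%:E)%E by rewrite lte_fin.
apply: lb_le_inf.
- have [M [_ HM]] := cvg_cdfy1 X (open_nbhs_nbhs (conj (@open_ereal_gt_ereal R t%:E) t1e)).
  have M1 : M < M + 1 by rewrite ltrDl.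
  by exists (M + 1); exact: ltW (HM _ M1).
- move=> x /= tx; apply: ge_inf; last by apply: le_trans tx; rewrite lee_fin.
  have [M [_ HM]] := cvg_cdfNy0 X (open_nbhs_nbhs (conj (@open_ereal_lt_ereal R s%:E) s0e)).
  exists M => y /= sy; rewrite leNgt; apply/negP => /HM /=.
  by rewrite cdfE ltNge sy.
Qed.

Lemma measurable_quantile mu :
  measurable_fun [set: line R] (quantile mu : line R -> line R).
Proof.
have -> : [set: line R] = `]-oo, 0] `|` (`]0, 1[ `|` ([set 1] `|` `]1, +oo[)).
  apply/seteqP; split=> // t _ /=; rewrite !in_itv/= !andbT.
  by case: (leP t 0); case: (ltgtP t 1) => //; intuition.
apply/measurable_funU => //; first by do !apply: measurableU => //.
split.
  apply: (eq_measurable_fun (cst (inf setT))) => // t.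
  rewrite inE/= in_itv/= => t0; rewrite /quantile; congr inf.
  apply/seteqP; split => // x _ /=.
  by rewrite (@le_trans _ _ 0%E)// lee_fin.
apply/measurable_funU => //; first by do !apply: measurableU => //.
split.
  apply: (measurability (@RGenCInfty.G R)) => [|/= _ [_] [r] -> <-].
    exact: RGenCInfty.measurableE.
  apply: (@is_interval_measurable R) => a b /=.
  rewrite !in_itv/= !andbT => -[/andP[a0 a1] ra] [/andP[b0 b1] rb] x.
  move=> /andP[ax xb]; have x0 := lt_le_trans a0 ax.
  have x1 := le_lt_trans xb b1; split; first by rewrite in_itv/= x0.
  rewrite /= in_itv/= andbT.
  by apply: le_trans ra _; exact: quantile_nondecreasing.
apply/measurable_funU => //; split; first exact: measurable_fun_set1.
apply: (eq_measurable_fun (cst (inf set0))) => // t.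
rewrite inE/= in_itv/= andbT => t1; rewrite /quantile; congr inf.
apply/seteqP; split => // x /=.
by apply/negP; rewrite -ltNge (le_lt_trans (probability_le1 mu _)).
Qed.

Definition com_map mu nu (t : line R) : plane R :=
  (quantile mu t, quantile nu t).

Definition ant_map mu nu (t : line R) : plane R :=
  (quantile mu t, quantile nu (1 - t)).

Lemma measurable_com_map mu nu : measurable_fun setT (com_map mu nu).
Proof.
by apply: measurable_fun_pair; exact: measurable_quantile.
Qed.

Lemma measurable_ant_map mu nu : measurable_fun setT (ant_map mu nu).
Proof.
apply: measurable_fun_pair; first exact: measurable_quantile.
apply: (measurableT_comp (measurable_quantile nu)).
exact: measurable_funB.
Qed.

HB.instance Definition _ mu nu := isMeasurableFun.Build _ _ _ _
  (com_map mu nu) (measurable_com_map mu nu).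

HB.instance Definition _ mu nu := isMeasurableFun.Build _ _ _ _
  (ant_map mu nu) (measurable_ant_map mu nu).

Definition uniform01 : probability (line R) R := uniform_prob (@ltr01 R).

Definition pi_com mu nu : probability (plane R) R :=
  distribution uniform01 (com_map mu nu).

Definition pi_ant mu nu : probability (plane R) R :=
  distribution uniform01 (ant_map mu nu).

(* For c in the cost class of the marginals of pi, the negative part of c is
   integrable, so this integral is well defined in ]-oo, +oo]. *)
Definition quadratic_cost (c : plane R * plane R -> R) pi : \bar R :=
  (\int[(pi \x pi)%E]_z (c z)%:E)%E.

Definition minimizer_over {T : Type} (A : set T) (F : T -> \bar R) (a : T) :=
  A a /\ forall b, A b -> (F a <= F b)%E.

End definitions.

(* Main.v *)
From HB Require Import structures.
Require Import Defs.
From mathcomp Require Import all_boot all_order all_algebra.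
From mathcomp Require Import all_classical all_reals all_analysis.
From mathcomp Require Import measurable_realfun lra.
Import Order.TTheory GRing.Theory Num.Theory.
Local Open Scope classical_set_scope.
Local Open Scope ring_scope.

Set Implicit Arguments.
Unset Strict Implicit.
Unset Printing Implicit Defensive.

(** The quadratic problem reduces to two linear ones, and each linear one is
    solved by Kantorovich duality on the support of the candidate coupling.

    Reduction. The lower bound [f (x, x') + g (y, y')] has the same finite
    double integral for every coupling, so it can be subtracted from [c]. What
    remains is a nonnegative cost [e], and subtracting a function of [x] plus a
    function of [y] from either section preserves sub- and supermodularity. If
    [pi0] minimizes every linear problem with such a section as cost, then by
    Tonelli [pi0] can replace [pi] first in one factor of [pi \x pi] and then
    in the other, without ever increasing the integral of [e]
    ([quadratic_minimizer]).

    Linear problem. Let [h >= 0] be submodular and let [Gamma] be a totally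
    ordered subset of the plane, here the curve [t |-> (Q_mu t, Q_nu t)]. On a
    finite set of points of [Gamma], pairing the abscissas with the ordinates
    in increasing order minimizes the sum of the values of [h]
    ([closed_walk_ge0]). As in Rockafellar's theorem on cyclically monotone
    sets, infima over walks then give potentials with
    [phi x + psi y <= h (x, y)] everywhere and equality on [Gamma]
    ([submodular_dual_potentials]). They are measurable although they are
    infima over uncountable families: after subtraction of [h (x, 0)] each
    family splits into nondecreasing and nonincreasing functions of [x]
    ([measurable_section_inf]).

    The potentials need not be integrable, so they are truncated at level [n].
    The truncated sums have the same integral for all couplings; since
    [h >= 0] they stay below [h], and on [Gamma] they are nonnegative and
    converge to [h]. Fatou's lemma gives the optimality of a coupling carried
    by [Gamma] ([dual_potentials_optimal]).

    The supermodular case follows by reflecting the second coordinate, which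
    exchanges sub- and supermodular functions and turns an antimonotone curve
    into a comonotone one. *)

(** * Cyclical monotonicity of comonotone sets *)

Section cyclical_monotonicity.
Context {R : realType}.
Implicit Types (h : R * R -> R) (p q r : R * R) (Gamma : set (R * R)).

Definition below p q := (p.1 <= q.1) && (p.2 <= q.2).

Definition comonotone Gamma :=
  forall p q, Gamma p -> Gamma q -> below p q || below q p.

Lemma submodular_le h x x' y y' : submodular h -> x <= x' -> y <= y' ->
  h (x, y) + h (x', y') <= h (x, y') + h (x', y).
Proof.
move=> hh; rewrite le_eqVlt => /predU1P[->|xx']; first by rewrite addrC.
rewrite le_eqVlt => /predU1P[->//|yy']; exact: hh.
Qed.

(** The price of moving from the point [p] to the point [q] of a comonotone
    set: the ordinate of [p] gets coupled to the abscissa of [q] instead of to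
    its own. Cyclical monotonicity says that closed walks have a nonnegative
    total price. *)
Definition step h p q := h (q.1, p.2) - h p.

Fixpoint walk h p (l : seq (R * R)) q :=
  if l is r :: l' then step h p r + walk h r l' q else step h p q.

Lemma walk_cat h p l1 r l2 q :
  walk h p (l1 ++ r :: l2) q = walk h p l1 r + walk h r l2 q.
Proof. by elim: l1 p => //= s l1 IH p; rewrite IH addrA. Qed.

(** A local maximum [r] of a walk can be removed: by submodularity, uncrossing
    the two steps through [r] does not increase the price. *)
Lemma step_shortcut h p q r : submodular h -> below p r -> below q r ->
  step h p q <= step h p r + step h r q.
Proof.
case: p q r => [p1 p2] [q1 q2] [r1 r2] hh /andP[/= pr1 pr2] /andP[/= qr1 qr2].
rewrite /step/=; have := submodular_le hh qr1 pr2; lra.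
Qed.

Lemma comonotone_max Gamma p l : comonotone Gamma ->
  (forall r, r \in p :: l -> Gamma r) ->
  exists2 m, m \in p :: l & forall r, r \in p :: l -> below r m.
Proof.
move=> G; elim: l p => [|q l IH] p pl.
  exists p; first by rewrite inE.
  by move=> r; rewrite inE => /eqP ->; rewrite /below !lexx.
have [|m mq mP] := IH q; first by move=> r rl; apply: pl; rewrite inE rl orbT.
have Gp : Gamma p by apply: pl; rewrite inE eqxx.
have Gm : Gamma m by apply: pl; rewrite inE mq orbT.
have [pm|mp] := orP (G _ _ Gp Gm).
  exists m; first by rewrite inE mq orbT.
  by move=> r; rewrite inE => /predU1P[->//|]; exact: mP.
exists p; first by rewrite inE eqxx.
move=> r; rewrite inE => /predU1P[->|/mP]; first by rewrite /below !lexx.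
move: mp; rewrite /below => /andP[mp1 mp2] /andP[rm1 rm2].
by rewrite (le_trans rm1)// (le_trans rm2).
Qed.

(** Induction on the length: rotate the walk so that it starts and ends at its
    largest point, and cut that point off by [step_shortcut]. *)
Lemma closed_walk_ge0 h Gamma p l : submodular h -> comonotone Gamma ->
  (forall r, r \in p :: l -> Gamma r) -> 0 <= walk h p l p.
Proof.
move=> hh G; have [n] := ubnP (size l).
elim: n p l => // n IH p l ln pl.
have [m ml mP] := comonotone_max G pl.
(* Rotate the closed walk so that it is based at its maximum m. *)
have {p l pl ml ln mP} [l [-> ln lG mP]] : exists l', [/\ walk h p l p = walk h m l' m,
    (size l' < n.+1)%N, forall r, r \in m :: l' -> Gamma r &
    forall r, r \in l' -> below r m].
  move: ml; rewrite inE => /predU1P[mp|ml].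
    by exists l; rewrite mp; split => // r rl; rewrite -mp; apply: mP; rewrite inE rl orbT.
  case/splitPr : ml ln pl mP => l1 l2 ln pl mP.
  exists (l2 ++ p :: l1); split.
  - by rewrite !walk_cat addrC.
  - by move: ln; rewrite !size_cat/= !addnS addnC.
  - by move=> r rl; apply: pl; move: rl;
      rewrite !(inE, mem_cat) => /or4P[] ->; rewrite ?orbT.
  - by move=> r rl; apply: mP; move: rl;
      rewrite !(inE, mem_cat) => /or3P[] ->; rewrite ?orbT.
case: l ln lG mP => [|c l] ln lG mP /=; first by rewrite /step -surjective_pairing subrr.
case/lastP : l ln lG mP => [|l d] ln lG mP /=.
  have cm : below c m by apply: mP; rewrite inE.
  have := step_shortcut hh cm cm.
  by rewrite {1}/step -surjective_pairing subrr addrC.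
rewrite -cats1 walk_cat/=.
have cl : 0 <= walk h c (rcons l d) c.
  apply: IH; first by move: ln; rewrite /= ltnS.
  by move=> r rl; apply: lG; rewrite inE rl orbT.
have dc : step h d c <= step h d m + step h m c.
  by apply: step_shortcut hh _ _; apply: mP; rewrite !(inE, mem_rcons) eqxx ?orbT.
move: cl; rewrite -cats1 walk_cat/=; lra.
Qed.

(** Rockafellar's construction: [u q] is the infimum of the prices of the walks
    from a base point to [q], which is finite because closing such a walk gives
    a nonnegative price. *)
Lemma walk_potential h Gamma : submodular h -> comonotone Gamma ->
  exists u : R * R -> R,
    forall p q, Gamma p -> Gamma q -> u q <= u p + step h p q.
Proof.
move=> hh G; have [->|/set0P[p0 Gp0]] := eqVneq Gamma set0; first by exists (cst 0).
pose W q := [set walk h p0 l q | l in [set l | forall r, r \in l -> Gamma r]].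
have W0 q : W q !=set0 by exists (walk h p0 [::] q), [::].
have Wlb q : Gamma q -> has_lbound (W q).
  move=> Gq; exists (- step h q p0) => _ [l /= lG <-].
  rewrite -subr_ge0 opprK -[step h q p0]/(walk h q [::] p0) -walk_cat.
  apply: (closed_walk_ge0 hh G) => r.
  by rewrite !(inE, mem_cat) => /or3P[/eqP->||/eqP->]//; exact: lG.
exists (fun q => inf (W q)) => p q Gp Gq.
rewrite -lerBlDr; apply: lb_le_inf => // _ [l /= lG <-].
rewrite lerBlDr; apply: ge_inf; first exact: Wlb.
exists (l ++ [:: p]); last by rewrite walk_cat.
by move=> r /=; rewrite !(inE, mem_cat) => /orP[|/eqP->]//; exact: lG.
Qed.

End cyclical_monotonicity.

(** * Measurable dual potentials *)

Section dual_potentials.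
Context {R : realType}.
Implicit Types (h : R * R -> R) (p q r : R * R) (Gamma : set (R * R)).
Local Open Scope ereal_scope.

Lemma nondecreasing_emeasurable (f : R -> \bar R) :
  {homo f : x y / (x <= y)%R >-> x <= y} ->
  measurable_fun [set: measurableTypeR R] f.
Proof.
move=> f_nd; apply: (measurability (@ErealGenCInfty.G R)).
  exact: ErealGenCInfty.measurableE.
move=> /= _ [_ [r ->] <-]; rewrite setTI.
apply: is_interval_measurable => s t /=.
rewrite !in_itv/= !andbT => fs ft z /andP[sz zt].
by rewrite in_itv/= andbT (le_trans fs)// f_nd.
Qed.

Lemma nonincreasing_emeasurable (f : R -> \bar R) :
  {homo f : x y / (x <= y)%R >-> y <= x} ->
  measurable_fun [set: measurableTypeR R] f.
Proof.
move=> f_ni; have -> : f = \- (\- f) by apply/funext => x; rewrite oppeK.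
apply: measurableT_comp => //; apply: nondecreasing_emeasurable => x y xy.
by rewrite leeN2 f_ni.
Qed.

Definition section_inf h (A : set (R * R)) (x : R) : \bar R :=
  ereal_inf [set (h (x, a.1) + a.2)%:E | a in A].

Lemma section_inf_setU h (A B : set (R * R)) x :
  section_inf h (A `|` B) x = mine (section_inf h A x) (section_inf h B x).
Proof.
apply/le_anti/andP; split.
  by rewrite le_min; apply/andP; split; apply: ereal_inf_le_tmp;
    apply: image_subset; [exact: subsetUl | exact: subsetUr].
apply: le_ereal_inf_tmp => _ [a [Aa|Ba] <-].
  by rewrite ge_min; apply/orP; left; apply: ereal_inf_lbound; exists a.
by rewrite ge_min; apply/orP; right; apply: ereal_inf_lbound; exists a.
Qed.

Lemma section_inf_shift h (g : R -> R) A x :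
  section_inf h A x =
  (g x)%:E + section_inf (fun p => h p - g p.1)%R A x.
Proof.
apply/le_anti/andP; split.
  rewrite -leeBlDl//; apply: le_ereal_inf_tmp => _ [a Aa <-].
  rewrite leeBlDl// -EFinD; apply: ereal_inf_lbound; exists a => //.
  by congr EFin => /=; lra.
apply: le_ereal_inf_tmp => _ [a Aa <-].
rewrite addeC -leeBrDr// -EFinB; apply: ereal_inf_lbound; exists a => //.
by congr EFin => /=; lra.
Qed.

(** The infimum may range over an uncountable family. Submodularity says that
    [h (x, y) - h (x, 0)] is nonincreasing in [x] for [y >= 0] and nondecreasing
    for [y <= 0], and an infimum of monotone functions of the same sense is
    monotone, hence measurable. *)
Lemma measurable_section_inf h A : submodular h ->
  (forall y, measurable_fun setT (fun x : measurableTypeR R => h (x, y))) ->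
  measurable_fun [set: measurableTypeR R] (section_inf h A).
Proof.
move=> hh mh.
pose h0 p := (h p - h (p.1, 0))%R.
pose Aneg := A `&` [set a | a.1 <= 0]%R; pose Apos := A `&` [set a | 0 <= a.1]%R.
have -> : section_inf h A = (fun x => (h (x, 0)%R)%:E +
    mine (section_inf h0 Aneg x) (section_inf h0 Apos x)).
  apply/funext => x.
  rewrite (section_inf_shift h (fun x => h (x, 0)%R)) -section_inf_setU.
  rewrite -setIUr (_ : _ `|` _ = setT) ?setIT//.
  by apply/seteqP; split => // -[a b] _ /=; exact/orP/le_total.
apply: emeasurable_funD; first exact/measurable_EFinP.
apply: measurable_mine.
  apply: nondecreasing_emeasurable => x y xy.
  apply: le_ereal_inf_tmp => _ [a [Aa /= a0] <-].
  apply: (@le_trans _ _ (h0 (x, a.1) + a.2)%:E).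
    by apply: ereal_inf_lbound; exists a.
  rewrite lee_fin /h0/=; have := submodular_le hh xy a0; lra.
apply: nonincreasing_emeasurable => x y xy.
apply: le_ereal_inf_tmp => _ [a [Aa /= a0] <-].
apply: (@le_trans _ _ (h0 (y, a.1) + a.2)%:E).
  by apply: ereal_inf_lbound; exists a.
rewrite lee_fin /h0/=; have := submodular_le hh xy a0; lra.
Qed.

Definition swap h : R * R -> R := fun p => h (p.2, p.1).

Lemma swap_submodular h : submodular h -> submodular (swap h).
Proof.
by move=> hh x x' y y' xx' yy'; rewrite /swap/=; have := hh _ _ _ _ yy' xx'; lra.
Qed.

Definition dual_potentials h Gamma (phi psi : measurableTypeR R -> \bar R) :=
  [/\ measurable_fun setT phi, measurable_fun setT psi,
      forall x y, phi x + psi y <= (h (x, y))%:E &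
      forall p, Gamma p -> phi p.1 + psi p.2 = (h p)%:E].

(** With [u] from [walk_potential], [phi x] is the infimum over [q] in [Gamma] of
    [u q + h (x, q.2) - h q], and [psi y] is the infimum of [h (x, y) - phi x].
    The inequality for [u] says that [phi p.1 = u p] on [Gamma]; the infimum
    defining [psi p.2] is then attained at [x = p.1]. Off the projections of
    [Gamma] the potentials may take the value [-oo]. *)
Lemma submodular_dual_potentials h Gamma : submodular h -> comonotone Gamma ->
  Gamma !=set0 -> measurable_fun [set: measurableTypeR R * measurableTypeR R] h ->
  exists phi psi, dual_potentials h Gamma phi psi.
Proof.
move=> hh G [p0 Gp0] mh.
have [u uP] := walk_potential hh G.
pose phi := section_inf h [set (q.2, u q - h q)%R | q in Gamma].
(* Only the x with phi x finite are kept, so that - phi x is a real number. *)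
pose psi := section_inf (swap h)
  [set (x, - fine (phi x))%R | x in [set x | phi x \is a fin_num]].
have phiE p : Gamma p -> phi p.1 = (u p)%:E.
  move=> Gp; apply/le_anti/andP; split.
    apply: ereal_inf_lbound; eexists; first by exists p.
    by rewrite /= -surjective_pairing addrC subrK.
  apply: le_ereal_inf_tmp => _ [_ [q Gq <-] <-] /=.
  by rewrite lee_fin; have := uP _ _ Gq Gp; rewrite /step; lra.
have phi_le q x : Gamma q -> phi x <= (h (x, q.2) + (u q - h q))%:E.
  by move=> Gq; apply: ereal_inf_lbound; eexists; first by exists q.
exists phi, psi; split.
- apply: measurable_section_inf => // y.
  by apply: measurableT_comp mh _; exact: measurable_pair2.
- apply: measurable_section_inf; first exact: swap_submodular.
  by move=> x; apply: measurableT_comp mh _; exact: measurable_pair1.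
- move=> x y.
  have [fx|] := boolP (phi x \is a fin_num).
    rewrite addeC -leeBrDr//.
    by apply: ereal_inf_lbound; eexists; [by exists x|rewrite /= EFinB fineK].
  rewrite fin_numE negb_and !negbK => /orP[/eqP->|/eqP phioo].
    by rewrite addNye leNye.
  by have := phi_le _ x Gp0; rewrite phioo.
move=> p Gp; rewrite phiE//; apply/le_anti/andP; split.
  rewrite addeC -leeBrDr//; apply: ereal_inf_lbound; eexists.
    by exists p.1 => //=; rewrite phiE.
  by rewrite /= phiE//= /swap/= -surjective_pairing EFinB.
rewrite addeC -leeBlDr//; apply: le_ereal_inf_tmp => _ [_ [x fx <-] <-].
have := phi_le _ x Gp; rewrite -(fineK fx) /= -EFinB !lee_fin /swap/=; lra.
Qed.
End dual_potentials.

(** * Optimality from dual potentials *)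

Section linear.
Context {R : realType}.
Local Open Scope ereal_scope.

(** Truncation of [e] to [[-n, n]], shifted by [n]. The shift makes the values
    nonnegative, so that no integrability has to be discussed before the
    integrals of two truncated potentials are added. *)
Definition clip (n : nat) (e : \bar R) : \bar R :=
  maxe 0 (mine (e + n%:R%:E) (n%:R + n%:R)%:E).

Lemma clip_ge0 n e : 0 <= clip n e.
Proof. by rewrite /clip le_max lexx. Qed.

Lemma measurable_clip d (T : measurableType d) n (f : T -> \bar R) :
  measurable_fun setT f -> measurable_fun setT (clip n \o f).
Proof.
move=> mf; apply: measurable_maxe => //; apply: measurable_mine => //.
by apply: emeasurable_funD.
Qed.

Lemma clip_fin n (r : R) : clip n r%:E =
  (Num.max 0 (Num.min (r + n%:R) (n%:R + n%:R)))%:E%R.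
Proof. by rewrite /clip -EFinD -EFin_min -EFin_max. Qed.

(** Truncation moves both summands towards 0. If one of them is raised to [-n],
    the truncated sum is at most 0, hence at most [h]; otherwise both summands
    decrease. *)
Lemma clip_upper n (e f : \bar R) (h : R) : (0 <= h)%R -> e + f <= h%:E ->
  clip n e + clip n f <= h%:E + (n%:R + n%:R)%:E.
Proof.
have n0 : (0 <= n%:R :> R)%R by [].
have clipNy : clip n -oo = 0 by rewrite /clip addNye min_l ?leNye// max_l// leNye.
move=> h0.
have clip_le (e' : \bar R) : clip n e' <= h%:E + (n%:R + n%:R)%:E.
  apply: (@le_trans _ _ (n%:R + n%:R)%:E); last by rewrite leeDr ?lee_fin.
  by rewrite /clip ge_max ge_min lexx orbT lee_fin addr_ge0.
case: e => [e| |]; case: f => [f| |]; rewrite ?clipNy ?leye_eq//=.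
- rewrite !clip_fin -!EFinD !lee_fin; move: (n%:R : R)%R n0 => a a0 ef.
  by case: (leP (e + a)%R) => ?; case: (leP (f + a)%R) => ?;
  do 2?[case: (leP 0%R) => ?]; lra.
- by rewrite adde0.
- by rewrite adde0.
- by rewrite add0e.
- by rewrite add0e.
- by move=> _; rewrite adde0 -EFinD lee_fin !addr_ge0.
Qed.

(** Dual to [clip_upper]: if one of the summands is lowered to [n], the truncated
    sum is at least 0; otherwise both summands increase. *)
Lemma clip_lower n (e f : \bar R) (h : R) : (0 <= h)%R -> e + f = h%:E ->
  (n%:R + n%:R)%:E <= clip n e + clip n f.
Proof.
have n0 : (0 <= n%:R :> R)%R by [].
move=> h0; case: e f => [e| |] [f| |] //= [ef].
rewrite !clip_fin -!EFinD !lee_fin; move: (n%:R : R)%R n0 => a a0.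
by case: (leP (e + a)%R) => ?; case: (leP (f + a)%R) => ?;
  do 2?[case: (leP 0%R) => ?]; lra.
Qed.

Lemma clip_cvg (e f : \bar R) (h : R) : e + f = h%:E ->
  (clip n e + clip n f - (n%:R + n%:R)%:E) @[n --> \oo] --> h%:E.
Proof.
case: e f => [e| |] [f| |] //= [ef].
apply: cvg_near_cst; near=> n.
have en : (`|e| <= n%:R)%R by near: n; exact: nbhs_infty_ger.
have fn : (`|f| <= n%:R)%R by near: n; exact: nbhs_infty_ger.
move: en fn; rewrite !ler_norml => /andP[e1 e2] /andP[f1 f2].
rewrite !clip_fin -!EFinD; congr EFin; rewrite !min_l ?max_r; lra.
Unshelve. all: by end_near. Qed.

Lemma limn_einf_le (u : (\bar R)^nat) c : (forall n, u n <= c) -> limn_einf u <= c.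
Proof.
move=> uc; rewrite limn_einf_lim; apply: lime_le; first exact: is_cvg_einfs.
apply: nearW => n; apply: le_trans (uc n); apply: ereal_inf_lbound.
by exists n => //=.
Qed.

Implicit Types (mu nu : probability (line R) R) (pi : probability (plane R) R).

(** Phrased with null sets because [Gamma] is not assumed measurable. *)
Definition concentrated_on pi (Gamma : set (plane R)) :=
  forall N, measurable N -> N `<=` ~` Gamma -> pi N = 0.

Lemma integral_marginals mu nu pi (a b : line R -> \bar R) : couplings mu nu pi ->
  measurable_fun setT a -> measurable_fun setT b ->
  (forall x, 0 <= a x) -> (forall y, 0 <= b y) ->
  \int[pi]_p (a p.1 + b p.2) = \int[mu]_x a x + \int[nu]_y b y.
Proof.
move=> [pimu pinu] ma mb a0 b0; rewrite ge0_integralD//; first last.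
- exact: measurableT_comp mb measurable_snd.
- exact: measurableT_comp ma measurable_fst.
have -> : \int[mu]_x a x = \int[pushforward pi fst]_x a x.
  by apply: eq_measure_integral => A mA _; exact/esym/pimu.
have -> : \int[nu]_x b x = \int[pushforward pi snd]_x b x.
  by apply: eq_measure_integral => A mA _; exact/esym/pinu.
by rewrite !ge0_integral_pushforward.
Qed.

(** Weak duality would give this at once for integrable potentials. Here the
    truncated potentials have equal integrals under [pi0] and [pi] since the
    marginals agree, and Fatou's lemma on the measurable set [E] where
    [phi + psi = h], which contains [Gamma], removes the truncation. *)
Lemma dual_potentials_optimal mu nu pi0 pi (h : plane R -> R) Gamma phi psi :
  couplings mu nu pi0 -> couplings mu nu pi -> concentrated_on pi0 Gamma ->
  measurable_fun setT h -> (forall p, 0 <= h p)%R ->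
  dual_potentials h Gamma phi psi ->
  \int[pi0]_p (h p)%:E <= \int[pi]_p (h p)%:E.
Proof.
move=> c0 c1 conc mh h0 [mphi mpsi le_h eq_h].
pose E := [set p : plane R | phi p.1 + psi p.2 = (h p)%:E].
have mphi1 : measurable_fun setT (fun p : plane R => phi p.1).
  exact: measurableT_comp mphi measurable_fst.
have mpsi2 : measurable_fun setT (fun p : plane R => psi p.2).
  exact: measurableT_comp mpsi measurable_snd.
have mhE : measurable_fun setT (EFin \o h) by exact/measurable_EFinP.
have mE : measurable E.
  rewrite -[E]setTI; apply: measurable_eqe => //; exact: emeasurable_funD.
have pi0E : pi0 (~` E) = 0.
  apply: conc; first exact: measurableC.
  by apply: subsetC => p /eq_h.
pose S n p := clip n (phi p.1) + clip n (psi p.2).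
have mS n : measurable_fun setT (S n).
  by apply: emeasurable_funD; apply: (measurable_clip n).
have S0 n p : 0 <= S n p by apply: adde_ge0; exact: clip_ge0.
pose c n : \bar R := (n%:R + n%:R)%:E.
rewrite (@ge0_negligible_integral _ _ _ pi0 setT (~` E))//; last 2 first.
  exact: measurableC.
  by move=> p _; rewrite lee_fin.
rewrite setTD setCK.
rewrite (eq_integral (fun p => limn_einf (fun n => S n p - c n))); last first.
  move=> p /set_mem Ep.
  by rewrite (cvg_limn_einf_sup (clip_cvg Ep)).
apply: le_trans (fatou _ _ _ _) _ => //.
- by move=> n; apply: emeasurable_funB => //; exact: measurable_funTS.
- move=> n p Ep; rewrite sube_ge0//; exact: clip_lower Ep.
apply: limn_einf_le => n.
(* The constant 2n, the shift in the two truncations, is added to both sides,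
   as its integral on E and on the whole plane respectively. *)
have cfin : c n * 1 \is a fin_num by rewrite mule1.
rewrite -(leeD2rE _ _ cfin).
have pi0E1 : pi0 E = 1.
  rewrite -(setCK E) probability_setC; last exact: measurableC.
  by rewrite pi0E sube0.
rewrite -{1}pi0E1 -integral_cst// -ge0_integralD//; first last.
- by move=> p _; rewrite lee_fin addr_ge0.
- by apply: emeasurable_funB => //; exact: measurable_funTS.
- by move=> p Ep; rewrite sube_ge0//; exact: clip_lower Ep.
rewrite (eq_integral (S n)); last by move=> p _; rewrite /cst subeK.
apply: (@le_trans _ _ (\int[pi0]_p S n p)); first exact: ge0_subset_integral.
rewrite /S (integral_marginals c0 (measurable_clip n mphi) (measurable_clip n mpsi)).
all: try by move=> x; exact: clip_ge0.
rewrite -(integral_marginals c1 (measurable_clip n mphi) (measurable_clip n mpsi)).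
all: try by move=> x; exact: clip_ge0.
rewrite -(@probability_setT _ _ _ pi) -integral_cst// -ge0_integralD//.
- apply: ge0_le_integral => //.
  + by move=> p _; exact: S0.
  + exact: mS.
  + exact: emeasurable_funD.
  + by move=> [x y] _; exact: clip_upper.
- by move=> p _; rewrite lee_fin.
- by move=> p _; rewrite lee_fin addr_ge0.
Qed.
End linear.

(** * From linear to quadratic costs *)

Section quadratic.
Context {R : realType}.
Local Open Scope ereal_scope.
Implicit Types (mu nu : probability (line R) R) (pi : probability (plane R) R).

(** The integral of [e] may be infinite, so the additivity of the integral on
    integrable functions does not apply. The identity between positive and
    negative parts [(k + e)^+ + k^- = (k + e)^- + (k^+ + e)] only involves
    nonnegative functions, and all its terms except [(k + e)^+] and [e] have
    finite integrals. *)
Lemma integralD_ge0 d (T : measurableType d) (m : {measure set T -> \bar R}) (k e : T -> R) :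
  m.-integrable setT (EFin \o k) -> measurable_fun setT e -> (forall x, 0 <= e x)%R ->
  \int[m]_x (k x + e x)%:E = \int[m]_x (k x)%:E + \int[m]_x (e x)%:E.
Proof.
move=> ik me e0.
have mk : measurable_fun setT k by apply/measurable_EFinP; exact: measurable_int ik.
have mc : measurable_fun setT (k \+ e)%R by exact: measurable_funD.
have mcE : measurable_fun setT (EFin \o (k \+ e)%R) by exact/measurable_EFinP.
have mkE : measurable_fun setT (EFin \o k) by exact/measurable_EFinP.
have meE : measurable_fun setT (EFin \o e) by exact/measurable_EFinP.
have kp : \int[m]_x ((EFin \o k)^\+ x) \is a fin_num.
  exact: integrable_pos_fin_num.
have kn : \int[m]_x ((EFin \o k)^\- x) \is a fin_num.
  exact: integrable_neg_fin_num.
have cn : \int[m]_x ((EFin \o (k \+ e)%R)^\- x) \is a fin_num.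
  rewrite ge0_fin_numE ?integral_ge0//.
  apply: (@le_lt_trans _ _ (\int[m]_x ((EFin \o k)^\- x))).
    apply: ge0_le_integral => //; [exact: measurable_funeneg..|].
    move=> x _; rewrite !funenegE /= -!EFin_max lee_fin ge_max !le_max lexx orbT andbT.
    by have := e0 x; rewrite lerN2; lra.
  by rewrite ltey_eq kn.
have : \int[m]_x ((EFin \o (k \+ e)%R)^\+ x + (EFin \o k)^\- x) =
       \int[m]_x ((EFin \o (k \+ e)%R)^\- x + ((EFin \o k)^\+ x + (EFin \o e) x)).
  apply: eq_integral => x _; rewrite !funenegE !funeposE /= -!EFin_max -!EFinD; congr EFin.
  by case: (leP (k x + e x)%R) => ?; case: (leP (- (k x + e x))%R) => ?;
   case: (leP (k x)%R) => ?; case: (leP (- k x)%R) => ?; lra.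
rewrite !ge0_integralD//.
all: try by move=> x _; rewrite ?adde_ge0 ?lee_fin.
all: try exact: measurable_funeneg.
all: try exact: measurable_funepos.
all: try by apply: emeasurable_funD => //; exact: measurable_funepos.
rewrite [X in _ -> X = _]integralE [X in _ -> _ = X + _]integralE.
move: kp kn cn.
set kp := \int[m]_x (EFin \o k)^\+ x; set kn := \int[m]_x (EFin \o k)^\- x.
set cn := \int[m]_x (EFin \o (k \+ e)%R)^\- x.
set cp := \int[m]_x (EFin \o (k \+ e)%R)^\+ x.
rewrite -[\int[m]_x (e x)%:E]/(\int[m]_x (EFin \o e) x).
set ee := \int[m]_x (EFin \o e) x.
rewrite -[cp - cn]/(cp - cn).
case: kp => // kp _; case: kn => // kn _; case: cn => // cn _.
case: cp ee => [cp| |] [ee| |] //= [] //; rewrite -?EFinD => h; congr EFin; lra.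
Qed.

Section pushforward_product.
Context d1 d2 (X : measurableType d1) (Y : measurableType d2).
Variables (P : probability X R) (Q : probability Y R) (phi : X -> Y).
Hypothesis mphi : measurable_fun setT phi.
Hypothesis PQ : forall A, measurable A -> pushforward P phi A = Q A.

Let phi2 (z : X * X) : Y * Y := (phi z.1, phi z.2).

Let mphi2 : measurable_fun setT phi2.
Proof. by apply: measurable_fun_pair; exact: measurableT_comp. Qed.

Let ge0_integral_comp (F : Y -> \bar R) : measurable_fun setT F ->
  (forall y, 0 <= F y) -> \int[P]_x F (phi x) = \int[Q]_y F y.
Proof.
move=> mF F0; have -> : \int[Q]_y F y = \int[pushforward P phi]_y F y.
  by apply: eq_measure_integral => A mA _; exact/esym/PQ.
by rewrite ge0_integral_pushforward.
Qed.

Lemma ge0_integral_product_comp (F : Y * Y -> \bar R) : measurable_fun setT F ->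
  (forall y, 0 <= F y) ->
  \int[P \x P]_z F (phi2 z) = \int[Q \x Q]_z F z.
Proof.
move=> mF F0; have mF2 : measurable_fun setT (F \o phi2) by exact: measurableT_comp.
rewrite (fubini_tonelli1 (F \o phi2))//; last by move=> z; exact: F0.
rewrite (fubini_tonelli1 F)//.
rewrite -(ge0_integral_comp (F := fubini_F Q F)); last 2 first.
- exact: measurable_fun_fubini_tonelli_F.
- by move=> y; exact: integral_ge0.
apply: eq_integral => x _; rewrite /fubini_F /phi2/=.
apply: (ge0_integral_comp (F := fun y => F (phi x, y))) => //.
by apply: measurableT_comp mF _; exact: measurable_pair1.
Qed.

Lemma integrable_product_comp (f : Y * Y -> R) :
  (Q \x Q).-integrable setT (EFin \o f) ->
  (P \x P).-integrable setT (EFin \o (f \o phi2)).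
Proof.
move=> /integrableP[mf fi]; apply/integrableP; split.
  exact: (measurableT_comp mf mphi2).
have mabs : measurable_fun setT (abse \o (EFin \o f)) by exact: measurableT_comp.
apply: le_lt_trans fi; rewrite -(ge0_integral_product_comp mabs)//.
by move=> y; exact: abse_ge0.
Qed.

Lemma integral_product_comp (f : Y * Y -> R) :
  (Q \x Q).-integrable setT (EFin \o f) ->
  \int[P \x P]_z (f (phi2 z))%:E = \int[Q \x Q]_z (f z)%:E.
Proof.
move=> /measurable_int mf; rewrite integralE [RHS]integralE; congr (_ - _).
  rewrite -(ge0_integral_product_comp (measurable_funepos mf))//.
  by apply: eq_integral => z _; rewrite !funeposE.
rewrite -(ge0_integral_product_comp (measurable_funeneg mf))//.
by apply: eq_integral => z _; rewrite !funenegE.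
Qed.
End pushforward_product.

Definition marginally_optimal mu nu pi0 (h : plane R -> R) :=
  forall pi, couplings mu nu pi ->
    \int[pi0]_p (h p)%:E <= \int[pi]_p (h p)%:E.

(** The property of sub- and supermodularity that allows the lower bound of
    [cost_class] to be subtracted from the sections of the cost. *)
Definition separable_stable (K : set (plane R -> R)) :=
  forall (h : plane R -> R) (a b : R -> R), K h -> K (fun p => h p - (a p.1 + b p.2))%R.

(** With [e >= 0] the cost minus its lower bound, linear optimality of [pi0] for
    the sections of [e] yields
    [\int e d(pi0 x pi0) <= \int e d(pi x pi0) <= \int e d(pi x pi)]. *)
Lemma quadratic_minimizer mu nu pi0 (c : plane R * plane R -> R)
    (K : set (plane R -> R)) :
  cost_class mu nu c -> couplings mu nu pi0 -> separable_stable K ->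
  (forall h : plane R -> R, measurable_fun setT h -> (forall p, 0 <= h p)%R -> K h ->
     marginally_optimal mu nu pi0 h) ->
  (forall p, K (fun q => c (p, q))) -> (forall q, K (fun p => c (p, q))) ->
  minimizer_over (couplings mu nu) (quadratic_cost c) pi0.
Proof.
move=> [mc [f [g [fi gi fgc]]]] c0 Ksep Kopt Kr Kl; split => // pi c1.
pose k (z : plane R * plane R) := (f (z.1.1, z.2.1) + g (z.1.2, z.2.2))%R.
pose e z := (c z - k z)%R.
have e0 z : (0 <= e z)%R by case: z => [[x y] [x' y']]; rewrite subr_ge0; exact: fgc.
have k1i rho : couplings mu nu rho -> (rho \x rho).-integrable setT
    (EFin \o (fun z : plane R * plane R => f (z.1.1, z.2.1))).
  by move=> [cm _]; exact: (integrable_product_comp measurable_fst cm fi).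
have k2i rho : couplings mu nu rho -> (rho \x rho).-integrable setT
    (EFin \o (fun z : plane R * plane R => g (z.1.2, z.2.2))).
  by move=> [_ cn]; exact: (integrable_product_comp measurable_snd cn gi).
have ki rho : couplings mu nu rho -> (rho \x rho).-integrable setT (EFin \o k).
  move=> cr; have := integrableD measurableT (k1i _ cr) (k2i _ cr).
  by apply: eq_integrable => // z _.
have mk : measurable_fun setT k by apply/measurable_EFinP; exact: measurable_int (ki _ c0).
have me : measurable_fun setT e by exact: measurable_funB.
have meE : measurable_fun setT (EFin \o e) by exact/measurable_EFinP.
have costE rho : couplings mu nu rho -> quadratic_cost c rho =
    \int[mu \x mu]_z (f z)%:E + \int[nu \x nu]_z (g z)%:E + \int[rho \x rho]_z (e z)%:E.
  move=> cr; have [cm cn] := cr.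
  rewrite -(integral_product_comp measurable_fst cm fi).
  rewrite -(integral_product_comp measurable_snd cn gi).
  rewrite -integralD//; [|exact: k1i|exact: k2i].
  rewrite -(integralD_ge0 (ki _ cr))//; apply: eq_integral => z _.
  by rewrite /e addrC subrK.
rewrite !costE//; apply: leeD => //.
have E0 z : 0 <= (EFin \o e) z by rewrite lee_fin.
have optr p : \int[pi0]_q (EFin \o e) (p, q) <= \int[pi]_q (EFin \o e) (p, q).
  apply: (Kopt (fun q => e (p, q))) => //.
    by apply: measurableT_comp me _; exact: measurable_pair1.
  exact: (Ksep _ (fun x => f (p.1, x)) (fun y => g (p.2, y)) (Kr p)).
have optl q : \int[pi0]_p (EFin \o e) (p, q) <= \int[pi]_p (EFin \o e) (p, q).
  apply: (Kopt (fun p => e (p, q))) => //.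
    by apply: measurableT_comp me _; exact: measurable_pair2.
  exact: (Ksep _ (fun x => f (x, q.1)) (fun y => g (y, q.2)) (Kl q)).
rewrite (fubini_tonelli2 (EFin \o e))// (fubini_tonelli1 (EFin \o e))//.
apply: (@le_trans _ _ (\int[pi0]_q \int[pi]_p (EFin \o e) (p, q))).
  apply: ge0_le_integral => //.
  - by move=> q _; exact: integral_ge0.
  - exact: measurable_fun_fubini_tonelli_G.
  - exact: measurable_fun_fubini_tonelli_G.
  - by move=> q _; exact: optl.
have -> : \int[pi0]_q \int[pi]_p (EFin \o e) (p, q) =
    \int[pi]_p \int[pi0]_q (EFin \o e) (p, q).
  exact/esym/(fubini_tonelli (m1 := pi) (m2 := pi0)).
apply: ge0_le_integral => //.
- by move=> q _; exact: integral_ge0.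
- exact: (measurable_fun_fubini_tonelli_F (m2 := pi0)).
- exact: (measurable_fun_fubini_tonelli_F (m2 := pi)).
Qed.
End quadratic.

(** * The quantile couplings *)

Section couplings.
Context {R : realType}.
Implicit Types (mu nu : probability (line R) R) (pi : probability (plane R) R).

(** The open half-lines [`]x, +oo[], complements of the given ones, are stable
    under intersection and generate the Borel sets. *)
Lemma probability_line_eq mu nu :
  (forall x, mu `]-oo, x]%classic = nu `]-oo, x]%classic) ->
  forall A, measurable A -> mu A = nu A.
Proof.
move=> munu A mA.
apply: (@measure_unique _ R (line R) (@RGenOInfty.G R)
  (fun n => `]- n%:R, +oo[%classic) _ _ _ _ mu nu) => //.
- exact: RGenOInfty.measurableE.
- move=> _ _ [x ->] [y ->]; exists (Num.max x y); apply/seteqP; split => z /=;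
    by rewrite !in_itv/= !andbT gt_max => /andP.
- by move=> n; exists (- n%:R).
- rewrite -subTset => x _; exists (Num.bound `|x|) => //=.
  rewrite in_itv/= andbT ltrNl; apply: le_lt_trans (ler_norm _) _.
  by rewrite normrN; exact: archi_boundP.
- move=> _ [x ->].
  have -> : `]x, +oo[%classic = ~` `]-oo, x]%classic :> set R by rewrite setCitvl.
  transitivity (1 - mu `]-oo, x]%classic)%E; first exact: probability_setC.
  by rewrite munu; exact/esym/probability_setC.
- by move=> n; rewrite (le_lt_trans (probability_le1 _ _))// ltry.
Qed.

(** The Galois connection between the quantile and the distribution function;
    right-continuity of the latter makes the infimum a minimum. *)
Lemma quantile_le mu t x : 0 < t -> t < 1 ->
  (quantile mu t <= x) = (t%:E <= mu `]-oo, x]%classic)%E.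
Proof.
move=> t0 t1.
have cdf_nd y z : y <= z -> (mu `]-oo, y]%classic <= mu `]-oo, z]%classic)%E.
  by move=> yz; apply: le_measure; rewrite ?inE//; exact: subset_itvl.
pose idTR : line R -> R := idfun.
pose idm := @isMeasurableFun.Build _ _ _ _ idTR (@measurable_id _ _ setT).
pose X : {RV mu >-> R} := HB.pack idTR idm.
have cdfE y : cdf X y = mu `]-oo, y]%classic by [].
have t1e : (t%:E < 1)%E by rewrite lte_fin.
have t0e : (0 < t%:E)%E by rewrite lte_fin.
have lb : has_lbound [set y : R | (t%:E <= mu `]-oo, y]%classic)%E].
  have [M [_ HM]] := cvg_cdfNy0 X (open_nbhs_nbhs (conj (@open_ereal_lt_ereal R t%:E) t0e)).
  exists M => y /= ty; rewrite leNgt; apply/negP => /HM /=.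
  by rewrite cdfE ltNge ty.
have ne : [set y : R | (t%:E <= mu `]-oo, y]%classic)%E] !=set0.
  have [M [_ HM]] := cvg_cdfy1 X (open_nbhs_nbhs (conj (@open_ereal_gt_ereal R t%:E) t1e)).
  have M1 : M < M + 1 by rewrite ltrDl.
  by exists (M + 1); exact: ltW (HM _ M1).
apply/idP/idP => [qx|]; last by move=> tx; exact: ge_inf.
have gtx y : x < y -> (t%:E <= cdf X y)%E.
  move=> xy; have [z /= tz zy] := inf_lt ne (le_lt_trans qx xy).
  by apply: le_trans tz _; rewrite cdfE; apply: cdf_nd; exact: ltW.
rewrite -cdfE; have := @cdf_right_continuous _ _ _ _ X x.
move=> /cvg_lim <- //; apply: lime_ge.
  by apply/cvg_ex; exists (cdf X x); exact: cdf_right_continuous.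
near=> y; apply: gtx; near: y; exact: nbhs_right_gt.
Unshelve. all: by end_near. Qed.

Lemma uniform01E (U : set (line R)) : measurable U ->
  uniform01 U = lebesgue_measure (U `&` `[0, 1]%classic).
Proof.
move=> mU; rewrite /uniform01/= /uniform_prob integral_uniform_pdf.
rewrite (eq_integral (cst 1%E)); last first.
  by move=> x /set_mem[_]; rewrite /= in_itv/= /uniform_pdf => ->; rewrite subr0 invr1.
by rewrite integral_cst ?mul1e//; exact: measurableI.
Qed.

Lemma uniform01_outside (U : set (line R)) : measurable U ->
  (forall t, 0 < t < 1 -> ~ U t) -> uniform01 U = 0%E.
Proof.
move=> mU U0; rewrite uniform01E//.
apply/eqP; rewrite eq_le measure_ge0 andbT.
rewrite -(@countable_lebesgue_measure0 R [set 0; 1])//.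
  apply: le_measure; rewrite ?inE//; [exact: measurableI|exact: measurableU|].
  move=> t [Ut /=]; rewrite in_itv/= => /andP[t0 t1].
  have [t00|t00] := eqVneq t 0; first by left.
  have [t11|t11] := eqVneq t 1; first by right.
  by exfalso; apply: (U0 t _ Ut); rewrite !lt_neqAle t0 t1 t11 eq_sym t00.
by apply: finite_set_countable; exact: finite_set2.
Qed.

Lemma uniform01_eq (U V : set (line R)) : measurable U -> measurable V ->
  (forall t, 0 < t < 1 -> U t <-> V t) -> uniform01 U = uniform01 V.
Proof.
move=> mU mV UV.
have le_U (A B : set (line R)) : measurable A -> measurable B ->
    (forall t, 0 < t < 1 -> A t -> B t) -> (uniform01 A <= uniform01 B)%E.
  move=> mA mB AB; rewrite -[A](setDUK (@subIsetl _ A B)).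
  apply: (@le_trans _ _ (uniform01 (A `&` B) + uniform01 (A `\` (A `&` B)))%E).
    by apply: measureU2; [exact: measurableI | apply: measurableD => //; exact: measurableI].
  rewrite [X in (_ + X)%E]uniform01_outside ?adde0.
  - by apply: le_measure; rewrite ?inE//; exact: measurableI.
  - by apply: measurableD => //; exact: measurableI.
  - by move=> t t01 [At]; apply; split => //; exact: AB.
by apply/le_anti; rewrite !le_U// => t t01; apply UV.
Qed.

(** Stated for a uniform variable [S] on [0, 1], so that it applies both to the
    identity and to [t |-> 1 - t]. *)
Lemma law_quantile mu (S : line R -> line R) : measurable_fun setT S ->
  (forall t, 0 < t < 1 -> 0 < S t < 1) ->
  (forall a, 0 <= a <= 1 -> uniform01 (S @^-1` `]-oo, a]%classic) = a%:E) ->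
  forall A, measurable A -> uniform01 ((quantile mu \o S) @^-1` A) = mu A.
Proof.
move=> mS S01 Sa.
have mQ : measurable_fun setT (quantile mu \o S : line R -> line R).
  exact: measurableT_comp (measurable_quantile mu) mS.
pose X : {mfun line R >-> line R} := HB.pack (quantile mu \o S : line R -> line R)
  (isMeasurableFun.Build _ _ _ _ _ mQ).
apply: (@probability_line_eq (distribution uniform01 X) mu) => x.
have mux : mu `]-oo, x]%classic \is a fin_num by rewrite fin_num_measure.
rewrite -(fineK mux) -Sa; last first.
  by rewrite -!lee_fin fineK// measure_ge0 probability_le1.
have mSx : measurable (S @^-1` `]-oo, fine (mu `]-oo, x]%classic)]%classic).
  by rewrite -[X in measurable X]setTI; exact: mS.
have mQx : measurable ((quantile mu \o S) @^-1` `]-oo, x]%classic : set (line R)).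
  by rewrite -[X in measurable X]setTI; exact: (mQ measurableT).
rewrite [LHS](_ : _ = uniform01 ((quantile mu \o S) @^-1` `]-oo, x]%classic))//.
apply: uniform01_eq => // t t01 /=.
have /andP[S0 S1] := S01 _ t01.
by rewrite !in_itv/= quantile_le// -[(_ <= fine _)%R]lee_fin fineK.
Qed.

Lemma uniform01_ray (a : R) : 0 <= a <= 1 ->
  uniform01 (`]-oo, a]%classic : set (line R)) = a%:E.
Proof.
move=> /andP[a0 a1]; rewrite uniform01E//.
rewrite (_ : _ `&` _ = `[0, a]%classic).
  by rewrite lebesgue_measure_itv/= lte_fin; case: ltgtP a0 => // [_|<-] _; rewrite ?oppr0 ?adde0.
apply/seteqP; split => t /=; rewrite !in_itv/=; first by move=> [-> /andP[-> _]].
by move=> /andP[t0 ta]; rewrite ta t0 (le_trans ta).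
Qed.

Lemma uniform01_reflected_ray (a : R) : 0 <= a <= 1 ->
  uniform01 ((fun t : line R => 1 - t : line R) @^-1` `]-oo, a]%classic) = a%:E.
Proof.
move=> /andP[a0 a1].
have -> : (fun t : line R => 1 - t : line R) @^-1` `]-oo, a]%classic = `[1 - a, +oo[%classic.
  by apply/seteqP; split => t /=; rewrite !in_itv/= andbT; lra.
rewrite uniform01E//.
rewrite (_ : _ `&` _ = `[1 - a, 1]%classic).
  rewrite lebesgue_measure_itv/= lte_fin ltrBlDr ltrDl.
  by case: ltgtP a0 => // [_|<-] _ //; congr EFin; lra.
apply/seteqP; split => t /=; rewrite !in_itv/= ?andbT; first by move=> [-> /andP[_ ->]].
by move=> /andP[t0 ta]; rewrite ta t0/= andbT; split => //; lra.
Qed.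

Lemma law_quantile_uniform mu A : measurable A ->
  uniform01 (quantile mu @^-1` A) = mu A.
Proof.
apply: (@law_quantile _ idfun) => //; first exact: measurable_id.
by move=> a /uniform01_ray.
Qed.

Lemma pi_com_coupling mu nu : couplings mu nu (pi_com mu nu).
Proof.
by split => A; exact: law_quantile_uniform.
Qed.

Lemma pi_ant_coupling mu nu : couplings mu nu (pi_ant mu nu).
Proof.
split => A mA; first exact: law_quantile_uniform.
apply: (@law_quantile _ (fun t => 1 - t)) => //.
- exact: measurable_funB.
- by move=> t; lra.
- exact: uniform01_reflected_ray.
Qed.

Lemma concentrated_on_image (f : {mfun line R >-> plane R}) :
  concentrated_on (distribution uniform01 f) [set f t | t in `]0, 1[].
Proof.
move=> N mN Nf; apply: uniform01_outside.
  by rewrite -[X in measurable X]setTI; exact: measurable_funP.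
by move=> t t01 /Nf; apply; exists t => //=; rewrite in_itv.
Qed.

Lemma comonotone_com_map mu nu : comonotone [set com_map mu nu t | t in `]0, 1[].
Proof.
move=> _ _ [s + <-] [t + <-]; rewrite /= !in_itv/= => /andP[s0 s1] /andP[t0 t1].
apply/orP; have [st|/ltW ts] := leP s t; [left|right]; by rewrite /below/= !quantile_nondecreasing.
Qed.

Definition reflect2 (p : R * R) : R * R := (p.1, - p.2).

Lemma comonotone_reflected_ant_map mu nu :
  comonotone (reflect2 @^-1` [set ant_map mu nu t | t in `]0, 1[]).
Proof.
move=> p q [s + sp] [t + tq]; rewrite /= !in_itv/= => /andP[s0 s1] /andP[t0 t1].
case: p sp => p1 p2 [<- /esym/eqP]; rewrite eqr_oppLR => /eqP->.
case: q tq => q1 q2 [<- /esym/eqP]; rewrite eqr_oppLR => /eqP->.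
apply/orP; have [st|/ltW ts] := leP s t; [left|right];
  by apply/andP; split => /=; [|rewrite lerN2]; apply: quantile_nondecreasing => //; lra.
Qed.

(** [h (x, - y)] is submodular, so its potentials, reflected back, serve [h]. *)
Lemma supermodular_dual_potentials (h : plane R -> R) Gamma : supermodular h ->
  comonotone (reflect2 @^-1` Gamma) -> Gamma !=set0 -> measurable_fun setT h ->
  exists phi psi, dual_potentials h Gamma phi psi.
Proof.
move=> hh G [p Gp] mh.
have mr : measurable_fun setT (reflect2 : plane R -> plane R).
  apply: measurable_fun_pair; first exact: measurable_fst.
  by apply: measurableT_comp => //; exact: measurable_snd.
have [||||phi [psi [mphi mpsi le_h eq_h]]] :=
    @submodular_dual_potentials R (h \o reflect2) (reflect2 @^-1` Gamma).
- move=> x x' y y' xx' yy'; rewrite /reflect2/=.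
  by apply: hh => //; rewrite ltrN2.
- exact: G.
- by exists (reflect2 p); rewrite /preimage/= /reflect2/= opprK -surjective_pairing.
- exact: measurableT_comp.
exists phi, (psi \o -%R); split => //.
- exact: measurableT_comp.
- by move=> x y; have := le_h x (- y); rewrite /reflect2/= opprK.
- move=> q Gq; have := eq_h (reflect2 q).
  by rewrite /preimage/= /reflect2/= opprK -surjective_pairing; apply.
Qed.

Lemma submodular_separable_stable : separable_stable (@submodular R).
Proof. by move=> h a b hh x x' y y' xx' yy' /=; have := hh _ _ _ _ xx' yy'; lra. Qed.

Lemma supermodular_separable_stable : separable_stable (@supermodular R).
Proof. by move=> h a b hh x x' y y' xx' yy' /=; have := hh _ _ _ _ xx' yy'; lra. Qed.

End couplings.

Theorem theorem8 (R : realType) (mu nu : probability (line R) R)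
    (c : plane R * plane R -> R) (hc : cost_class mu nu c) :
  ((forall p : plane R, submodular (fun q => c (p, q))) ->
   (forall q : plane R, submodular (fun p => c (p, q))) ->
   minimizer_over (couplings mu nu) (quadratic_cost c) (pi_com mu nu)) /\
  ((forall p : plane R, supermodular (fun q => c (p, q))) ->
   (forall q : plane R, supermodular (fun p => c (p, q))) ->
   minimizer_over (couplings mu nu) (quadratic_cost c) (pi_ant mu nu)).
Proof.
have half : (`]0, 1[%classic : set R) (2^-1) by rewrite /= in_itv/=; lra.
split; apply: quadratic_minimizer hc _ _ _.
- exact: pi_com_coupling.
- exact: submodular_separable_stable.
- move=> h mh h0 hh pi cpi.
  have [|phi [psi pot]] := submodular_dual_potentials hh (@comonotone_com_map _ mu nu) _ mh.
    by exists (com_map mu nu 2^-1); exists 2^-1.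
  exact: (dual_potentials_optimal (pi_com_coupling mu nu) cpi
    (@concentrated_on_image _ (com_map mu nu)) mh h0 pot).
- exact: pi_ant_coupling.
- exact: supermodular_separable_stable.
- move=> h mh h0 hh pi cpi.
  have [|phi [psi pot]] := supermodular_dual_potentials hh
    (@comonotone_reflected_ant_map _ mu nu) _ mh.
    by exists (ant_map mu nu 2^-1); exists 2^-1.
  exact: (dual_potentials_optimal (pi_ant_coupling mu nu) cpi
    (@concentrated_on_image _ (ant_map mu nu)) mh h0 pot).
Qed.
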